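(* There exists a universal constant $\epsilon_0 > 0$ such that any non-adaptive (two-sided error) algorithm for testing whether an unknown Boolean function $f:\{-1,1\}^n\to\{-1,1\}$ is monotone versus $\epsilon_0$-far from monotone must make $\Omega(n^{1/5}(\log n)^{-2/5})$ queries. Consequently, any adaptive algorithm for this task must make $\Omega(\log n)$ queries.
   Context: For $x,y\in\{-1,1\}^n$ write $x\prec y$ if $x_i\le y_i$ for all $i\in[n]$ and $x\neq y$ (with $-1<1$). A function $f:\{-1,1\}^n\to\{-1,1\}$ is monotone if $f(x)\le f(y)$ whenever $x\prec y$. The distance $\mathrm{dist}(f,g)=\Pr_{\mathbf{x}}[f(\mathbf{x})\ne g(\mathbf{x})]$ for $\mathbf{x}$ uniform on $\{-1,1\}^n$; $f$ is $\epsilon$-far from monotone if $\mathrm{dist}(f,g)>\epsilon$ for every monotone $g$. A testing algorithm gets oracle (query) access to $f$ and must output Yes with probability at least $2/3$ if $f$ is monotone and No with probability at least $2/3$ if $f$ is $\epsilon_0$-far from monotone. It is non-adaptive if its queries do not depend on answers to previous queries. *)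

(* Defs.v *)
From mathcomp Require Export all_boot all_order all_algebra.
From mathcomp Require Export all_classical all_reals all_analysis.

Set Implicit Arguments.
Unset Strict Implicit.
Unset Printing Implicit Defensive.

Import Order.TTheory GRing.Theory Num.Theory.
Local Open Scope classical_set_scope.
Local Open Scope ring_scope.

(* The two-element chain {-1 < 1} is represented by bool, with false for -1
   and true for 1, so that [<=%O] on bool is the intended order. *)
Notation cube n := {ffun 'I_n -> bool}.
Notation boolfun n := {ffun cube n -> bool}.

Definition prec (n : nat) (x y : cube n) : Prop :=
  (forall i : 'I_n, (x i <= y i)%O) /\ x <> y.

Definition monotone (n : nat) (f : boolfun n) : Prop :=
  forall x y : cube n, prec x y -> (f x <= f y)%O.

Definition dist (R : realType) (n : nat) (f g : boolfun n) : R :=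
  #|[pred x : cube n | f x != g x]|%:R / #|{: cube n}|%:R.

Definition far_from_monotone (R : realType) (n : nat) (eps : R)
    (f : boolfun n) : Prop :=
  forall g : boolfun n, monotone g -> eps < dist R f g.

(* A deterministic query algorithm is a decision tree: [Query x k] asks the
   oracle for f x and goes on as [k (f x)]; [Output true] is the answer Yes. *)
Inductive query_alg (n : nat) : Type :=
| Output of bool
| Query of cube n & (bool -> query_alg n).

Fixpoint output (n : nat) (A : query_alg n) (f : boolfun n) : bool :=
  match A with
  | Output b => b
  | Query x k => output (k (f x)) f
  end.

Fixpoint queries (n : nat) (A : query_alg n) (f : boolfun n) : seq (cube n) :=
  match A with
  | Output _ => [::]
  | Query x k => x :: queries (k (f x)) f
  end.

(* A randomized algorithm is a family of deterministic ones indexed by the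
   random seed, which is drawn from a probability space (Omega, P).
   Measurability of the acceptance events is what makes the two
   probabilities below meaningful. *)
Definition monotonicity_tester (R : realType) (n : nat) (eps : R)
    (d : measure_display) (Omega : measurableType d) (P : probability Omega R)
    (A : Omega -> query_alg n) : Prop :=
  [/\ forall f : boolfun n, measurable [set w | output (A w) f = true],
      forall f : boolfun n, monotone f ->
        ((2 / 3)%:E <= P [set w | output (A w) f = true])%E
    & forall f : boolfun n, far_from_monotone eps f ->
        ((2 / 3)%:E <= P [set w | output (A w) f = false])%E].

Definition makes_at_most (n : nat) (Omega : Type) (A : Omega -> query_alg n)
    (q : nat) : Prop :=
  forall (w : Omega) (f : boolfun n), (size (queries (A w) f) <= q)%N.

(* Once the seed is fixed, the oracle's answers do not affect the queries. *)
Definition nonadaptive (n : nat) (Omega : Type) (A : Omega -> query_alg n) :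
    Prop :=
  forall (w : Omega) (f g : boolfun n), queries (A w) f = queries (A w) g.

(* Main.v *)
Require Import Defs.
From mathcomp Require Import all_boot all_order all_algebra.
From mathcomp Require Import all_classical all_reals all_analysis.
From mathcomp Require Import measurable_realfun ring lra.
Set Implicit Arguments.
Unset Strict Implicit.
Unset Printing Implicit Defensive.

Import Order.TTheory GRing.Theory Num.Theory.
Local Open Scope classical_set_scope.
Local Open Scope ring_scope.

(** The hard functions are random Talagrand DNFs. Draw [N = 2 ^ (w - 2)] terms,
   each a conjunction of [w ~ sqrt (n / 32)] uniform variables, and a uniform
   coordinate [k i] for each term [i]. A point that satisfies a single term [i]
   gets the value of a literal on [x (k i)]: the positive one in the monotone
   functions, the negated one in the others; elsewhere the value is monotone.

   A typical point of the middle layers has a single term with constant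
   probability, and the edge through it in direction [k i] is then usually
   violated by the negated function, which is therefore far from monotone.

   A set [S] of queries can tell the two functions apart only through points of
   [S] sharing a single term [i]. If all of them agree on the coordinate [k i],
   what is seen is one bit, which negation hardly changes since a point with a
   single term is nearly balanced. If two of them, [x] and [y], differ at [k i],
   an event of probability [z = |x \ y| / n] (or symmetrically), then a term
   satisfied by [x] is satisfied by [y] with probability at most [(1 - z) ^ w],
   and [z (1 - z) ^ w <= 1 / (w + 1)]. Summing over pairs, the advantage is
   [O(|S| ^ 2 / w)], which tends to [0] when [|S| ^ 5 <= n].

   A non-adaptive algorithm with [q] queries has [|S| <= q], and a decision tree
   of depth [q] has [|S| < 2 ^ q]. *)

(** * Elementary inequalities *)

Section Inequalities.
Variable R : realType.
Implicit Types a b t : R.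

(** The left-hand side is the probability of exactly one success in [N] independent trials. The
    induction also carries the probability of no success. *)
Lemma bernoulli_one_success N t : 0 <= t <= 1 ->
  N%:R * (t * (1 - t) ^+ N.-1) <= 1.
Proof.
move=> /andP[t0 t1]; have u0 : 0 <= 1 - t by rewrite subr_ge0.
case: N => [|N]; first by rewrite mul0r ler01.
suff: N.+1%:R * (t * (1 - t) ^+ N) + (1 - t) ^+ N.+1 <= 1.
  by apply: le_trans; rewrite lerDl exprn_ge0.
elim: N => [|N IH]; first by rewrite expr0 expr1; lra.
have -> : N.+2%:R * (t * (1 - t) ^+ N.+1) + (1 - t) ^+ N.+2 =
  (1 - t) * (N.+1%:R * (t * (1 - t) ^+ N) + (1 - t) ^+ N.+1) + t * (1 - t) ^+ N.+1.
  by rewrite !exprS; ring.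
have h1 := ler_wpM2l u0 IH.
have h2 : t * (1 - t) ^+ N.+1 <= t.
  by rewrite -[leRHS]mulr1 ler_wpM2l // exprn_ile1 // lerBlDr lerDl.
by apply: le_trans (lerD h1 h2) _; rewrite mulr1 subrK.
Qed.

Lemma bernoulli_ineq m t : -1 <= t -> 1 + m%:R * t <= (1 + t) ^+ m.
Proof.
move=> t1; elim: m => [|m IH]; first by rewrite mul0r addr0 expr0.
have h : 0 <= 1 + t by rewrite -lerBlDl sub0r.
rewrite exprS; apply: le_trans (ler_wpM2l h IH).
have : 0 <= m%:R * (t * t) by rewrite mulr_ge0 ?ler0n // -expr2 sqr_ge0.
by rewrite -addn1 natrD; lra.
Qed.

(** Mean value bound, with the derivative of the power taken at the larger endpoint. *)
Lemma expr_sub_le m a b : 0 <= b -> b <= a ->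
  a ^+ m - b ^+ m <= m%:R * ((a - b) * a ^+ m.-1).
Proof.
move=> b0 ba; have a0 := le_trans b0 ba.
case: m => [|m]; first by rewrite !expr0 subrr mul0r.
elim: m => [|m IH]; first by rewrite !expr1 expr0 mulr1 mul1r.
have h1 := ler_wpM2l a0 IH.
have h2 : b ^+ m.+1 <= a ^+ m.+1 by apply: lerXn2r; rewrite ?nnegrE.
have h3 : (a - b) * b ^+ m.+1 <= (a - b) * a ^+ m.+1.
  by rewrite ler_wpM2l // subr_ge0.
rewrite /= [a ^+ m.+2]exprS [b ^+ m.+2]exprS -[m.+2%:R]natr1 mulrDl mul1r.
have -> : a * a ^+ m.+1 - b * b ^+ m.+1 =
  a * (a ^+ m.+1 - b ^+ m.+1) + (a - b) * b ^+ m.+1 by ring.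
apply: lerD => //; apply: le_trans h1 _.
by rewrite [in leRHS]exprS /= le_eqVlt; apply/orP; left; apply/eqP; ring.
Qed.

(* The exponent [N.-1] is split in two halves: each contributes a factor [2 / (N t)]. *)
Lemma bernoulli_one_success_inv N t : 0 <= t <= 1 -> ~~ odd N -> (0 < N)%N ->
  N%:R * t * (N%:R * (t * (1 - t) ^+ N.-1)) <= 4.
Proof.
move=> /andP[t0 t1] eN N0.
have N2 : (0 < N./2)%N by case: N eN N0 => [|[|]].
pose h := N./2.-1.
have Nh : N = (h.+1 * 2)%N.
  rewrite /h prednK //.
  by rewrite muln2 -[LHS]odd_double_half (negPf eN).
have u0 : 0 <= 1 - t by rewrite subr_ge0.
(* By Bernoulli the second factor is at most [(1 + t) ^+ h], and the product is then a power of
   [1 - t ^+ 2]. *)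
have hx : (1 - t) ^+ h * (1 + h%:R * t) <= 1.
  apply: (@le_trans _ _ ((1 - t) ^+ h * (1 + t) ^+ h)).
    by rewrite ler_wpM2l ?exprn_ge0 // bernoulli_ineq //; lra.
  by rewrite -exprMn exprn_ile1 //; nra.
have x0 : 0 <= (1 - t) ^+ h by rewrite exprn_ge0.
have x1 : (1 - t) ^+ h * (N%:R * t) <= 2.
  have : (1 - t) ^+ h * (N%:R * t) <= (1 - t) ^+ h * (2 * (1 + h%:R * t)).
    by rewrite ler_wpM2l // Nh natrM -addn1 natrD; lra.
  lra.
have y0 : 0 <= (1 - t) ^+ h * (N%:R * t) by rewrite !mulr_ge0.
have e1 : N%:R * t * (N%:R * (t * ((1 - t) ^+ h * (1 - t) ^+ h))) <= 4.
  rewrite [leLHS](_ : _ = (1 - t) ^+ h * (N%:R * t) * ((1 - t) ^+ h * (N%:R * t))).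
    by have := ler_pM y0 y0 x1 x1; lra.
  by ring.
apply: le_trans e1; do 3 (apply: ler_wpM2l; first by rewrite ?mulr_ge0).
have y2 : 1 - t <= 1 by lra.
have -> : N.-1 = (h + h).+1 by rewrite Nh muln2 doubleS -addnn.
by rewrite exprS exprD ler_piMl ?mulr_ge0.
Qed.

End Inequalities.

(** * Talagrand functions *)

Definition upd (I J : finType) (f : {ffun I -> J}) (a : I) (b : J) :
  {ffun I -> J} := [ffun i => if i == a then b else f i].

Definition weight (n : nat) (x : cube n) : nat := #|[pred j | x j]|.

Section Talagrand.
Variables n w N : nat.
Notation term := {ffun 'I_w -> 'I_n}.
Notation dnf := {ffun 'I_N -> {ffun 'I_w -> 'I_n}}.
Notation index := {ffun 'I_N -> 'I_n}.
Notation signs := {ffun 'I_N -> bool}.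
Implicit Types (T : dnf) (k : index) (s : signs) (x : cube n).

Definition sat (x : cube n) (t : term) : bool := [forall l, x (t l)].

Definition only_sat (T : dnf) (x : cube n) (i : 'I_N) : bool :=
  sat x (T i) && [forall j, (j != i) ==> ~~ sat x (T j)].

(* A point satisfying exactly one term [i] gets the value of the literal
   [x (k i) (+) s i]; with no satisfied term the value is [false], with at
   least two it is [true]. *)
Definition talagrand (T : dnf) (k : index) (s : signs) : boolfun n :=
  [ffun x => [exists i, sat x (T i) && (only_sat T x i ==> (x (k i) (+) s i))]].

Lemma sat_mono (x y : cube n) t :
  (forall i, x i -> y i) -> sat x t -> sat y t.
Proof. by move=> xy /forallP xt; apply/forallP => l; apply: xy. Qed.

Lemma only_sat_inj T x i j : only_sat T x i -> sat x (T j) -> j = i.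
Proof.
move=> /andP[_ /forallP /(_ j)]; case: eqVneq => //= _ /negP nj /nj //.
Qed.

(** Another term satisfied at [x] would be satisfied at [y] too. *)
Lemma only_sat_anti T (x y : cube n) i : (forall j, x j -> y j) ->
  sat x (T i) -> only_sat T y i -> only_sat T x i.
Proof.
move=> xy xi /andP[_ /forallP yu]; rewrite /only_sat xi /=.
apply/forallP => j; apply/implyP => ji; apply: contra (implyP (yu j) ji).
exact: sat_mono.
Qed.

Lemma talagrand_only_sat T k s x i : only_sat T x i ->
  talagrand T k s x = x (k i) (+) s i.
Proof.
move=> xi; rewrite ffunE; apply/existsP/idP => [[j /andP[xj]]|h].
  by rewrite (only_sat_inj xi xj) xi.
by exists i; rewrite h implybT andbT; case/andP: xi.
Qed.

(** Satisfied terms survive when going up. If [y] has no single term, it has at least two and its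
    value is [true]; otherwise its single term is also that of [x], and both values are the same
    positive literal. *)
Lemma talagrand_monotone T k : Defs.monotone (talagrand T k [ffun=> false]).
Proof.
move=> x y [xy _]; rewrite leEbool.
have {}xy j : x j -> y j by have := xy j; rewrite leEbool; case: (x j) (y j) => [] [].
case: (boolP (talagrand T k _ x)) => // fx; rewrite lt0b.
move: fx; rewrite ffunE => /existsP[i /andP[xi /implyP fxi]].
have yi := sat_mono xy xi.
case: (pselect (exists j, only_sat T y j)) => [[j yj]|ny]; last first.
  rewrite ffunE; apply/existsP; exists i; rewrite yi /=; apply/implyP => yi'.
  by case: ny; exists i.
have ij := only_sat_inj yj yi; subst j.
rewrite (talagrand_only_sat _ _ yj); have := fxi (only_sat_anti xy xi yj).
by rewrite !ffunE !addbF; apply: xy.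
Qed.

(** The entries [k i] and [s i] are read only at points whose single term is [i]. *)
Lemma talagrand_upd T k s x i a b : ~~ only_sat T x i ->
  talagrand T (upd k i a) (upd s i b) x = talagrand T k s x.
Proof.
move=> nx; rewrite !ffunE; apply: eq_existsb => j.
by rewrite !ffunE; case: eqVneq => // ->; rewrite (negPf nx).
Qed.

(* [x] together with its neighbour along the coordinate [k i] forms a violated
   edge of the negative function *)
Definition pivotal (T : dnf) (k : index) (x : cube n) (i : 'I_N) : bool :=
  [&& only_sat T x i, [forall l, T i l != k i] & only_sat T (upd x (k i) true) i].

(** Term [i] does not read the coordinate [k i], so it stays satisfied; its uniqueness comes down
    from the raised point. *)
Lemma pivotal_upd T k x i b : pivotal T k x i -> pivotal T k (upd x (k i) b) i.
Proof.
move=> /and3P[xi Ti xi1].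
have e : upd (upd x (k i) b) (k i) true = upd x (k i) true.
  by apply/ffunP => j; rewrite !ffunE; case: eqP.
rewrite /pivotal e Ti xi1 !andbT.
apply: (only_sat_anti _ _ xi1).
  by move=> j; rewrite !ffunE; case: eqP.
case/andP: xi => /forallP xi _; apply/forallP => l.
by rewrite ffunE (negPf (forallP Ti l)).
Qed.

(** Flipping [k i] matches the pivotal points into disjoint violated edges, and [g] differs from the
    negative function at one end of each. *)
Lemma pivotal_disagree T k (g : boolfun n) : Defs.monotone g ->
  (#|[pred x | [exists i, pivotal T k x i]]| <=
   2 * #|[pred x | talagrand T k [ffun=> true] x != g x]|)%N.
Proof.
move=> gm; set f := talagrand _ _ _; set D := [pred x | f x != g x].
set P := [pred x | _].
pose opp x := if [pick i | pivotal T k x i] is Some i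
  then upd x (k i) (~~ x (k i)) else x.
have oppE x i : pivotal T k x i -> opp x = upd x (k i) (~~ x (k i)).
  move=> xi; rewrite /opp; case: pickP => [j xj|/(_ i)]; last by rewrite xi.
  case/and3P: xi => xi _ _; case/and3P: xj => /andP[xj _] _ _.
  by rewrite (only_sat_inj xi xj).
have oppK : {in P, cancel opp opp}.
  move=> x /existsP[i xi]; rewrite (oppE _ _ xi) (oppE _ _ (pivotal_upd _ xi)).
  apply/ffunP => j; rewrite !ffunE eqxx negbK.
  by case: eqP => [->|].
(* A pivotal point or its partner is a disagreement; each of the two sets has at most [#|D|]
   elements since [opp] is injective on [P]. *)
have cover : P \subset [predU D & [predI P & [preim opp of D]]].
  apply/fintype.subsetP => x /[dup] xP /existsP[i xi].
  have xv b : f (upd x (k i) b) = ~~ b.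
    have /and3P[xo _ _] := pivotal_upd b xi.
    by rewrite /f (talagrand_only_sat _ _ xo) !ffunE eqxx addbT.
  have gv : (g (upd x (k i) false) <= g (upd x (k i) true))%O.
    apply: gm; split=> [j|/ffunP/(_ (k i))]; rewrite !ffunE ?eqxx //.
    by case: eqP.
  have xE : x = upd x (k i) (x (k i)).
    by apply/ffunP => j; rewrite ffunE; case: eqP => [->|].
  rewrite !inE (oppE _ _ xi) xv negbK {1 2}xE xv.
  rewrite (_ : [exists _, _]) /=; last by apply/existsP; exists i.
  move: gv; rewrite leEbool.
  by case: (x (k i)) => /=; do 2 case: (g _).
apply: leq_trans (subset_leq_card cover) _.
rewrite mul2n -addnn.
apply: (@leq_trans (#|D| + #|[predI P & [preim opp of D]]|)).
  by rewrite -cardUI leq_addr.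
rewrite leq_add2l -(@card_in_image _ _ opp); last first.
  move=> x y /andP[xP _] /andP[yP _] e.
  by rewrite -(oppK _ xP) e oppK.
apply: subset_leq_card; apply/fintype.subsetP => _ /fintype.imageP[x /andP[_ xD] ->].
exact: xD.
Qed.
End Talagrand.

(** * The hybrid argument *)

(** Resampling one entry keeps a random function uniform: swapping the old entry with the new one is
    an involution. *)
Lemma sum_upd (R : pzRingType) (I J : finType) (i : I) (phi : {ffun I -> J} -> R) :
  \sum_k \sum_j phi (upd k i j) = #|J|%:R * \sum_k phi k.
Proof.
rewrite mulr_natl -sumrMnl; under [RHS]eq_bigr do rewrite -sumr_const.
rewrite !pair_big /=.
pose h (p : {ffun I -> J} * J) := (upd p.1 i p.2, p.1 i).
rewrite [RHS](reindex_inj (_ : injective h)) //=.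
apply: (@can_inj _ _ _ h) => -[k j]; congr pair; last by rewrite ffunE eqxx.
by apply/ffunP => a; rewrite !ffunE; case: eqP => [->|].
Qed.

Lemma mem_ler_sum (R : numDomainType) (I : eqType) (s : seq I) (F : I -> R) r :
  r \in s -> (forall x, 0 <= F x) -> F r <= \sum_(x <- s) F x.
Proof. by move=> rs F0; rewrite (big_rem r) //= lerDl sumr_ge0. Qed.

Section Hybrid.
Variables (R : realType) (n w N : nat).
Notation dnf := {ffun 'I_N -> {ffun 'I_w -> 'I_n}}.
Notation index := {ffun 'I_N -> 'I_n}.
Notation signs := {ffun 'I_N -> bool}.
Implicit Types (T : dnf) (k : index) (s : signs) (x y : cube n).

Definition excess x y : R := \sum_j (x j && ~~ y j)%:R.
Definition bias x : R := \sum_j (if x j then 1 else -1).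

(** Bounds the effect of negating the literal of term [i]. The estimate compares the points of [S]
    with single term [i] to one of them, [x]; summing over all candidates [x] avoids a choice. The
    factor [excess x y + excess y x] is the Hamming distance. *)
Definition group_dev (S : seq (cube n)) T i : R :=
  \sum_(x <- S) ((only_sat T x i)%:R * `|bias x| +
    2 * \sum_(y <- S) (only_sat T x i && only_sat T y i)%:R
                      * (excess x y + excess y x)).

Lemma excess_ge0 x y : 0 <= excess x y.
Proof. by apply: sumr_ge0 => j _; rewrite ler0n. Qed.

Lemma group_dev_term_ge0 S T i x :
  0 <= (only_sat T x i)%:R * `|bias x| +
    2 * \sum_(y <- S) (only_sat T x i && only_sat T y i)%:R
                      * (excess x y + excess y x).
Proof.
apply: addr_ge0; first by rewrite mulr_ge0.
rewrite mulr_ge0 //; apply: sumr_ge0 => y _.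
by rewrite mulr_ge0 // addr_ge0 ?excess_ge0.
Qed.

Variables (S : seq (cube n)) (A : boolfun n -> bool).
Hypothesis AS : forall f g : boolfun n, {in S, f =1 g} -> A f = A g.

(** If no point of [S] has single term [i], the change is invisible. Otherwise fix such a point [r]
    and let all points of its group read the literal at [r]: the cost is the number of disagreements
    with [r], and what remains is one bit, whose average over [j] is governed by the bias of [r]. *)
Lemma hybrid_step T k s i :
  `|\sum_j ((A (talagrand T (upd k i j) (upd s i true)))%:R -
            (A (talagrand T (upd k i j) (upd s i false)))%:R)|
    <= group_dev S T i.
Proof.
pose F j b : R := (A (talagrand T (upd k i j) (upd s i b)))%:R.
rewrite -/(F _ _); under eq_bigr do rewrite -/(F _ true) -/(F _ false).
case: (boolP (has (fun x => only_sat T x i) S)) => [/hasP[r rS ri]|/hasPn nS].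
  2: {
  rewrite big1 ?normr0; first by apply: sumr_ge0 => x _; apply: group_dev_term_ge0.
  move=> j _; rewrite /F (AS (g := talagrand T k s)); last first.
    by move=> x /nS; apply: talagrand_upd.
  rewrite (AS (f := talagrand T _ (upd s i false)) (g := talagrand T k s)).
    by rewrite subrr.
  by move=> x /nS; apply: talagrand_upd. }
(* The answer when the whole group of [i] receives the constant [c]; it does not depend on [j]. *)
pose Phi c : R :=
  (A [ffun x => if only_sat T x i then c else talagrand T k s x])%:R.
(* If [spl j] vanishes, replacing the literal by its value at [r] is exact; otherwise it is at least
   1, which bounds any change of the answer. *)
pose spl j : R := \sum_(y <- S) (only_sat T y i)%:R * (r j != y j)%:R.
have key j b : `|F j b - Phi (r j (+) b)| <= spl j.
  case: (boolP (all (fun y => only_sat T y i ==> (r j == y j)) S)) => [/allP al|].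
    rewrite /F (AS (g := [ffun x => if only_sat T x i then r j (+) b
                                    else talagrand T k s x])).
      by rewrite subrr normr0; apply: sumr_ge0 => y _; rewrite mulr_ge0.
    move=> y yS; rewrite [RHS]ffunE; case: ifPn => yi; last exact: talagrand_upd.
    rewrite (talagrand_only_sat _ _ yi) !ffunE eqxx.
    by have := al y yS; rewrite yi /= => /eqP->.
  rewrite -has_predC => /hasP[y yS /=]; rewrite negb_imply => /andP[yi ry].
  apply: (@le_trans _ _ 1).
    by rewrite /F /Phi; case: (A _); case: (A _);
       rewrite ?subrr ?subr0 ?sub0r ?normrN ?normr0 ?normr1.
  have := @mem_ler_sum R _ S
    (fun y => (only_sat T y i)%:R * (r j != y j)%:R) y yS.
  by rewrite yi ry mulr1; apply => z; rewrite mulr_ge0.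
have splE : \sum_j spl j =
    \sum_(y <- S) (only_sat T r i && only_sat T y i)%:R * (excess r y + excess y r).
  rewrite exchange_big /=; apply: eq_bigr => y _; rewrite ri /= -mulr_sumr.
  congr (_ * _); rewrite /excess -big_split /=; apply: eq_bigr => j _.
  by case: (r j); case: (y j); rewrite ?addr0 ?add0r.
(* Coordinates where [r] is [true] and where it is [false] contribute opposite amounts, so only
   their imbalance remains. *)
have mid : `|\sum_j (Phi (r j (+) true) - Phi (r j (+) false))| <= `|bias r|.
  have -> : \sum_j (Phi (r j (+) true) - Phi (r j (+) false)) =
      (Phi false - Phi true) * bias r.
    rewrite /bias mulr_sumr; apply: eq_bigr => j _.
    by case: (r j) => /=; rewrite ?mulr1 // mulrN1 opprB.
  rewrite normrM ler_piMl // /Phi; case: (A _); case: (A _);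
  by rewrite ?subrr ?subr0 ?sub0r ?normrN ?normr0 ?normr1.
have sumkey b : `|\sum_j (F j b - Phi (r j (+) b))| <= \sum_j spl j.
  by apply: le_trans (ler_norm_sum _ _ _) _; apply: ler_sum => j _; apply: key.
apply: (@le_trans _ _ (`|bias r| + 2 * \sum_j spl j)).
  have -> : \sum_j (F j true - F j false) =
     \sum_j (F j true - Phi (r j (+) true))
     + \sum_j (Phi (r j (+) true) - Phi (r j (+) false))
     - \sum_j (F j false - Phi (r j (+) false)).
    by rewrite -sumrN -!big_split /=; apply: eq_bigr => j _; ring.
  apply: le_trans (ler_normB _ _) _.
  have := ler_normD (\sum_j (F j true - Phi (r j (+) true)))
    (\sum_j (Phi (r j (+) true) - Phi (r j (+) false))).
  have := sumkey true; have := sumkey false; move: mid; lra.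
rewrite splE -[`|bias r|]mul1r.
have := mem_ler_sum rS (group_dev_term_ge0 S T i).
by rewrite {1}ri.
Qed.

(** The signs are negated one at a time; at step [i], [sum_upd] resamples [k i], which accounts for
    the factor [n]. *)
Lemma hybrid T :
  n%:R * `|\sum_k ((A (talagrand T k [ffun=> true]))%:R -
                   (A (talagrand T k [ffun=> false]))%:R)|
    <= #|{: index}|%:R * \sum_i group_dev S T i.
Proof.
pose st m : signs := [ffun i : 'I_N => (i < m)%N].
pose u m : R := \sum_k (A (talagrand T k (st m)))%:R.
have -> : \sum_k ((A (talagrand T k [ffun=> true]))%:R -
                   (A (talagrand T k [ffun=> false]))%:R) = u N - u 0%N.
  rewrite sumrB; congr (_ - _); apply: eq_bigr => k _; congr ((A (talagrand _ _ _))%:R);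
  by apply/ffunP => i; rewrite !ffunE ?ltn_ord ?ltn0.
rewrite -(telescope_sumr _ (leq0n N)) big_mkord -{1}[n%:R]ger0_norm ?ler0n //.
rewrite -normrM !mulr_sumr; apply: le_trans (ler_norm_sum _ _ _) _.
apply: ler_sum => i _; rewrite /u -sumrB -[n in n%:R]card_ord -(sum_upd i).
apply: le_trans (ler_norm_sum _ _ _) _.
rewrite mulr_natl -sumr_const; apply: ler_sum => k _.
have -> : st i.+1 = upd (st i) i true.
  apply/ffunP => j; rewrite !ffunE.
  case: eqVneq => [->|/negPf ji]; first by rewrite ltnS leqnn.
  by rewrite ltnS leq_eqVlt (_ : (val j == val i) = false).
have {2}-> : st i = upd (st i) i false.
  by apply/ffunP => j; rewrite !ffunE; case: eqVneq => [->|]; rewrite ?ltnn.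
exact: hybrid_step.
Qed.

End Hybrid.

(** * Averages over the random terms *)

Lemma prod_indicator (R : comPzRingType) (I : finType) (P b : pred I) :
  \prod_(j | P j) (b j)%:R = [forall j, P j ==> b j]%:R :> R.
Proof.
case: (boolP [forall j, _]) => [/forallP h|/forallPn[j]].
  by rewrite big1 // => j Pj; have := h j; rewrite Pj /= => ->.
rewrite negb_imply => /andP[Pj /negPf bj].
by rewrite (bigD1 j) //= bj mul0r.
Qed.

Section Expectation.
Variables (R : realType) (n w N : nat).
Notation term := {ffun 'I_w -> 'I_n}.
Notation dnf := {ffun 'I_N -> {ffun 'I_w -> 'I_n}}.
Notation index := {ffun 'I_N -> 'I_n}.
Implicit Types (T : dnf) (k : index) (x y : cube n).
Hypothesis n_gt0 : (0 < n)%N.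

Let n0 : 0 < n%:R :> R. Proof. by rewrite ltr0n. Qed.

Definition density x : R := (weight x)%:R / n%:R.

Lemma weight_le x : (weight x <= n)%N.
Proof. by rewrite -[leqRHS]card_ord max_card. Qed.

Lemma density_itv x : 0 <= density x <= 1.
Proof.
by rewrite divr_ge0 //= ler_pdivrMr // mul1r ler_nat weight_le.
Qed.

Lemma weightE x : (weight x)%:R = \sum_j (x j)%:R :> R.
Proof.
rewrite /weight -sum1_card natr_sum big_mkcond /=; apply: eq_bigr => j _.
by rewrite inE; case: (x j).
Qed.

Lemma biasE x : bias R x = n%:R * (2 * density x - 1).
Proof.
have -> : n%:R * (2 * density x - 1) = 2 * (weight x)%:R - n%:R :> R.
  by rewrite /density; field; rewrite gt_eqF.
rewrite weightE mulr_sumr -[n in X in _ = _ - X]card_ord -sum1_card natr_sum -sumrB.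
by apply: eq_bigr => j _; case: (x j); rewrite ?mulr1 ?mulr0; lra.
Qed.

(** Independence of the terms. Distinct [P] and [Q] allow the condition on term [i] and the one on
    the other terms to concern different points. *)
Lemma sum_one_term (i : 'I_N) (P Q : pred term) :
  \sum_(T : dnf) (P (T i) && [forall j, (j != i) ==> ~~ Q (T j)])%:R =
  #|{: dnf}|%:R * (#|P|%:R / (n ^ w)%:R * (1 - #|Q|%:R / (n ^ w)%:R) ^+ N.-1) :> R.
Proof.
pose F (j : 'I_N) (t : term) : R := if j == i then (P t)%:R else (~~ Q t)%:R.
have tE : #|{: term}| = (n ^ w)%N by rewrite card_ffun !card_ord.
have t0 : (n ^ w)%:R != 0 :> R by rewrite pnatr_eq0 expn_eq0 negb_and -lt0n n_gt0.
have cE (B : pred term) : \sum_t (B t)%:R = #|B|%:R :> R.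
  rewrite -sum1_card natr_sum [RHS]big_mkcond; apply: eq_bigr => t _.
  by rewrite unfold_in; case: (B t).
transitivity (\sum_(T : dnf) \prod_j F j (T j)).
  apply: eq_bigr => T _; rewrite (bigD1 i) //= {1}/F eqxx.
  rewrite (eq_bigr (fun j => (~~ Q (T j))%:R)); last first.
    by move=> j /negPf ji; rewrite /F ji.
  by rewrite prod_indicator -natrM mulnb.
rewrite -bigA_distr_bigA (bigD1 i) //= {1}/F eqxx cE.
rewrite (eq_bigr (fun=> (n ^ w)%:R - #|Q|%:R)); last first.
  move=> j /negPf ji; rewrite /F ji -(cE Q) -tE -sum1_card natr_sum -sumrB.
  by apply: eq_bigr => t _; case: (Q t); rewrite ?subrr ?subr0.
rewrite prodr_const cardC1 card_ord card_ffun tE card_ord.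
have -> : 1 - #|Q|%:R / (n ^ w)%:R = ((n ^ w)%:R - #|Q|%:R) / (n ^ w)%:R :> R.
  by rewrite mulrBl divff.
have -> : ((n ^ w) ^ N)%:R = (n ^ w)%:R * (n ^ w)%:R ^+ N.-1 :> R.
  by rewrite -exprS prednK ?(leq_ltn_trans _ (ltn_ord i)) // -natrX.
rewrite expr_div_n; field.
by rewrite expf_neq0.
Qed.

Lemma card_sat x : #|sat (w := w) x|%:R / (n ^ w)%:R = density x ^+ w :> R.
Proof.
rewrite /density expr_div_n !natrX; congr (_ / _); rewrite -natrX; congr _%:R.
transitivity #|@ ffun_on 'I_w [pred j | x j]|; last first.
  by rewrite card_ffun_on card_ord.
by apply: eq_card => t; apply/forallP/ffun_onP.
Qed.

Definition common x y : R := #|[pred j | x j && y j]|%:R / n%:R.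

Lemma card_sat2 x y :
  #|[pred t : term | sat x t && sat y t]|%:R / (n ^ w)%:R = common x y ^+ w :> R.
Proof.
rewrite /common expr_div_n !natrX; congr (_ / _); rewrite -natrX; congr _%:R.
transitivity #|@ ffun_on 'I_w [pred j | x j && y j]|; last first.
  by rewrite card_ffun_on card_ord.
apply: eq_card => t; rewrite inE; apply/andP/ffun_onP => [[/forallP h1 /forallP h2] l|h].
  by rewrite inE h1 h2.
by split; apply/forallP => l; have := h l; rewrite inE => /andP[].
Qed.

Lemma excessE x y : excess R x y = n%:R * (density x - common x y).
Proof.
have -> : n%:R * (density x - common x y) =
    (weight x)%:R - #|[pred j | x j && y j]|%:R.
  by rewrite /density /common; field; rewrite gt_eqF.
rewrite weightE -sum1_card natr_sum [in X in _ - X]big_mkcond -sumrB.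
by apply: eq_bigr => j _; rewrite inE; case: (x j); case: (y j); rewrite ?subrr ?subr0.
Qed.

Lemma common_itv x y : 0 <= common x y <= density x.
Proof.
rewrite divr_ge0 //= ler_pM2r ?invr_gt0 // ler_nat.
by apply: subset_leq_card; apply/fintype.subsetP => j; rewrite !inE => /andP[].
Qed.

Lemma sum_only_sat x :
  \sum_i \sum_(T : dnf) (only_sat T x i)%:R =
  #|{: dnf}|%:R * (N%:R * (density x ^+ w * (1 - density x ^+ w) ^+ N.-1)).
Proof.
under eq_bigr do rewrite sum_one_term card_sat.
by rewrite sumr_const card_ord -[_ *+ N]mulr_natl; ring.
Qed.

Lemma density_pow_itv x : 0 <= density x ^+ w <= 1.
Proof.
by case/andP: (density_itv x) => a0 a1; rewrite exprn_ge0 // exprn_ile1.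
Qed.

Lemma sum_only_sat_le x : \sum_i \sum_(T : dnf) (only_sat T x i)%:R <= #|{: dnf}|%:R :> R.
Proof.
rewrite sum_only_sat ler_piMr // bernoulli_one_success //.
exact: density_pow_itv.
Qed.

(* The density of [y] inside [x] must be close to [1] for a term satisfied by [x]
   to be satisfied by [y]. *)
Lemma sum_only_sat_pair x y :
  (\sum_i \sum_(T : dnf) (only_sat T x i && only_sat T y i)%:R) * excess R x y
    <= #|{: dnf}|%:R * (n%:R / w.+1%:R).
Proof.
have dn0 : 0 <= #|{: dnf}|%:R :> R by [].
set a := density x; set c := common x y.
have /andP[a0 a1] : 0 <= a <= 1 := density_itv x.
have /andP[c0 ca] : 0 <= c <= a := common_itv x y.
have d0 : 0 <= a - c by rewrite subr_ge0.
(* Only the satisfaction of term [i] is kept for [y]; uniqueness is kept for [x]. *)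
apply: (@le_trans _ _ ((\sum_(i < N) #|{: dnf}|%:R *
   (c ^+ w * (1 - a ^+ w) ^+ N.-1)) * excess R x y)).
  rewrite ler_wpM2r ?excess_ge0 //; apply: ler_sum => i _.
  rewrite -card_sat2 -card_sat -(sum_one_term i); apply: ler_sum => T _.
  rewrite ler_nat; case: (boolP (only_sat T x i)) => //= /andP[xi xu].
  by case: (boolP (only_sat T y i)) => //= /andP[yi yu]; rewrite xi yi xu.
rewrite excessE -/a -/c sumr_const card_ord -[_ *+ N]mulr_natl.
have main : w.+1%:R * (N%:R * (c ^+ w * (1 - a ^+ w) ^+ N.-1) * (a - c)) <= 1.
  have [az|anz] := eqVneq a 0.
    have -> : c = 0 by apply/le_anti; rewrite c0 -az ca.
    by rewrite az subrr !mulr0.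
  have apos : 0 < a by rewrite lt_neqAle eq_sym anz.
  (* The fraction of [x] lying outside [y]. The quantity factors into [a] and two probabilities of
     exactly one success, in [N] and in [w.+1] trials. *)
  have [z zE] : exists z, z = (a - c) / a by exists ((a - c) / a).
  have z0 : 0 <= z by rewrite zE divr_ge0.
  have z1 : z <= 1 by rewrite zE ler_pdivrMr // mul1r lerBlDr lerDl.
  have -> : c = a * (1 - z) by rewrite zE; field.
  have -> : a - a * (1 - z) = a * z by ring.
  rewrite exprMn.
  have h1 := bernoulli_one_success N (density_pow_itv x); rewrite -/a in h1.
  have /(bernoulli_one_success w.+1) h2 : 0 <= z <= 1 by rewrite z0.
  rewrite /= in h2.
  have g1 : 0 <= N%:R * (a ^+ w * (1 - a ^+ w) ^+ N.-1).
    by rewrite !mulr_ge0 ?exprn_ge0 // subr_ge0 exprn_ile1.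
  have g2 : 0 <= w.+1%:R * (z * (1 - z) ^+ w).
    by rewrite !mulr_ge0 ?exprn_ge0 // subr_ge0.
  have := ler_pM g1 g2 h1 h2; rewrite mulr1 => g3.
  have := ler_pM a0 (mulr_ge0 g1 g2) a1 g3; rewrite mulr1; apply: le_trans.
  by rewrite le_eqVlt; apply/orP; left; apply/eqP; ring.
rewrite [leLHS](_ : _ = #|{: dnf}|%:R * n%:R *
  (N%:R * (c ^+ w * (1 - a ^+ w) ^+ N.-1) * (a - c))); last by ring.
rewrite [leRHS]mulrA ler_wpM2l ?mulr_ge0 // -[w.+1%:R^-1]mul1r.
rewrite ler_pdivlMr ?ltr0n // mulrC.
exact: main.
Qed.

Hypotheses (w_gt2 : (2 < w)%N) (NE : N = (2 ^ (w - 2))%N).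

Let w0 : 0 < w%:R :> R. Proof. by rewrite ltr0n (leq_trans _ w_gt2). Qed.

(** The mean number of satisfied terms: [1 / 4] at a balanced point, by the choice of [N]. *)
Lemma mean_sat x : N%:R * density x ^+ w = (1 + (2 * density x - 1)) ^+ w / 4.
Proof.
have -> : 1 + (2 * density x - 1) = 2 * density x by ring.
rewrite NE natrX [X in _ = X / _]exprMn.
have e : 2 ^+ w = 2 ^+ (w - 2) * 4 :> R.
  by rewrite -{1}(subnK (ltnW w_gt2)) exprD; congr (_ * _); ring.
by rewrite e; field.
Qed.

(** Well above the middle several terms are likely, so a single one is rare by
    [bernoulli_one_success_inv]; well below it, even the mean number of terms is small. *)
Lemma sum_only_sat_bias x :
  (\sum_i \sum_(T : dnf) (only_sat T x i)%:R) * `|bias R x|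
    <= #|{: dnf}|%:R * (n%:R * (16 / w%:R)).
Proof.
rewrite sum_only_sat biasE normrM ger0_norm; last exact: ltW.
have /andP[a0 a1] := density_itv x.
have := mean_sat x; have := bernoulli_one_success N (density_pow_itv x).
set t := density x ^+ w; set b := 2 * density x - 1.
have /andP[t0 t1] : 0 <= t <= 1 := density_pow_itv x.
set X := N%:R * (t * _) => X1 Nt.
have X0 : 0 <= X by rewrite !mulr_ge0 ?exprn_ge0 // subr_ge0.
suff key : w%:R * (X * `|b|) <= 16.
  rewrite -mulrA ler_wpM2l //.
  rewrite (_ : X * (n%:R * `|b|) = n%:R * (X * `|b|)); last by ring.
  by apply: ler_wpM2l; rewrite ?ler0n // ler_pdivlMr // mulrC.
case: (lerP 0 b) => b0.
  rewrite ger0_norm //.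
  have h1 : N%:R * t * X <= 4.
    apply: bernoulli_one_success_inv; rewrite ?t0 //.
      by rewrite NE oddX negb_or andbT -lt0n subn_gt0.
    by rewrite NE expn_gt0.
  have h2 : 1 + w%:R * b <= (1 + b) ^+ w by apply: bernoulli_ineq; lra.
  have h3 : w%:R * b / 4 * X <= N%:R * t * X by rewrite ler_wpM2r // Nt; lra.
  by have := le_trans h3 h1; lra.
rewrite ltr0_norm //; set c := - b.
have cE : 1 + b = 1 - c by rewrite /c opprK.
have /(bernoulli_one_success w.+1) h2 : 0 <= c <= 1.
  by apply/andP; split; rewrite /c; [lra | rewrite /b; lra].
rewrite /= in h2.
have XN : X <= N%:R * t.
  by rewrite /X mulrA ler_piMr ?mulr_ge0 // exprn_ile1 //; lra.
have c0 : 0 <= c by rewrite /c; lra.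
have h3 : w%:R * (X * c) <= w%:R * (N%:R * t * c).
  by rewrite ler_wpM2l ?ler_wpM2r // ltW.
apply: le_trans h3 _; rewrite Nt cE.
have h4 : 0 <= c * (1 - c) ^+ w by rewrite mulr_ge0 // exprn_ge0 // -cE /b; lra.
by move: h2; rewrite -natr1; lra.
Qed.

(** On average over [T], a point costs [16 n / w] through its bias and an ordered pair [4 n / w]
    through its Hamming distance. *)
Lemma sum_group_dev (S : seq (cube n)) :
  \sum_(T : dnf) \sum_i group_dev R S T i <=
  #|{: dnf}|%:R * (n%:R * (16 * (size S)%:R + 4 * (size S)%:R ^+ 2) / w%:R).
Proof.
pose s : R := (size S)%:R.
have sumS (c : R) : \sum_(x <- S) c = s * c.
  by rewrite big_const_seq count_predT iter_addr_0 mulr_natl.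
pose C : R := #|{: dnf}|%:R * n%:R / w%:R.
have C0 : 0 <= C by rewrite !mulr_ge0 // invr_ge0 ltW.
have pairC x y :
    (\sum_i \sum_(T : dnf) (only_sat T x i && only_sat T y i)%:R) * excess R x y <= C.
  apply: le_trans (sum_only_sat_pair x y) _.
  rewrite /C -mulrA; do 2 (apply: ler_wpM2l => //).
  by rewrite lef_pV2 ?posrE // ?ltr0n // ler_nat.
have -> : \sum_(T : dnf) \sum_i group_dev R S T i =
  \sum_(x <- S) ((\sum_i \sum_(T : dnf) (only_sat T x i)%:R) * `|bias R x| +
     2 * \sum_(y <- S) (\sum_i \sum_(T : dnf) (only_sat T x i && only_sat T y i)%:R)
                        * (excess R x y + excess R y x)).
  rewrite exchange_big /= /group_dev.
  under eq_bigr do rewrite exchange_big /=.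
  rewrite exchange_big /=; apply: eq_bigr => x _.
  under eq_bigr do rewrite big_split /= -mulr_suml -mulr_sumr.
  rewrite big_split /= -mulr_suml -mulr_sumr; congr (_ + 2 * _).
  under [LHS]eq_bigr do rewrite exchange_big /=.
  rewrite exchange_big /=; apply: eq_bigr => y _; rewrite mulr_suml.
  by apply: eq_bigr => i _; rewrite mulr_suml.
apply: (@le_trans _ _ (\sum_(x <- S) (16 * C + 2 * \sum_(y <- S) (2 * C)))).
  apply: ler_sum => x _; apply: lerD.
    by apply: le_trans (sum_only_sat_bias x) _; rewrite /C; lra.
  rewrite ler_wpM2l //; apply: ler_sum => y _; rewrite mulrDr.
  have := pairC x y; have := pairC y x.
  rewrite (_ : \sum_i \sum_(T : dnf) (only_sat T y i && only_sat T x i)%:R =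
    \sum_i \sum_(T : dnf) (only_sat T x i && only_sat T y i)%:R :> R).
    by move=> h1 h2; have := lerD h2 h1; lra.
  by apply: eq_bigr => i _; apply: eq_bigr => T _; rewrite andbC.
rewrite !sumS -/s /C le_eqVlt; apply/orP; left; apply/eqP; field.
by rewrite gt_eqF.
Qed.

End Expectation.

(** * Points of the middle layers *)

(** The product with [(1 - v) ^+ m] is at most 1, and that power is at least [1 / 2] by
    Bernoulli. *)
Lemma pow1D_le2 (R : realType) m (v : R) :
  -1 <= v <= 1 -> m%:R * v <= 1 / 2 -> (1 + v) ^+ m <= 2.
Proof.
move=> /andP[v0 v1] mv.
have h1 : 1 + m%:R * (- v) <= (1 - v) ^+ m by apply: bernoulli_ineq; lra.
have h2 : (1 + v) ^+ m * (1 - v) ^+ m <= 1.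
  by rewrite -exprMn exprn_ile1 //; nra.
have h3 : 0 <= (1 + v) ^+ m by rewrite exprn_ge0 //; lra.
have h4 : (1 + v) ^+ m * (1 / 2) <= (1 + v) ^+ m * (1 - v) ^+ m.
  by rewrite ler_wpM2l //; lra.
lra.
Qed.

(** Variance of a sum of [n] independent signs; flipping one coordinate shows that the cross terms
    vanish. *)
Lemma sum_bias_sqr (R : realType) n :
  \sum_(x : cube n) bias R x ^+ 2 = n%:R * #|{: cube n}|%:R.
Proof.
under eq_bigr do rewrite expr2 /bias big_distrlr /=.
rewrite exchange_big /=; under eq_bigr do rewrite exchange_big /=.
transitivity (\sum_(i < n) (#|{: cube n}|%:R : R)); last first.
  by rewrite sumr_const card_ord -[_ *+ n]mulr_natl.
apply: eq_bigr => i _.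
rewrite (bigD1 i) //= [X in _ + X]big1 ?addr0 => [|j ji].
  rewrite (eq_bigr (fun=> 1)) => [|x _]; first by rewrite sumr_const.
  by case: (x i); rewrite ?mulr1 ?mulrNN ?mulr1.
set s := \sum_x _; suff : s = - s by lra.
pose h (x : cube n) := upd x i (~~ x i).
have hK : involutive h.
  move=> x; apply/ffunP => a; rewrite !ffunE eqxx negbK.
  by case: eqP => [->|].
rewrite {1}/s (reindex_inj (inv_inj hK)) /= -sumrN; apply: eq_bigr => x _.
rewrite !ffunE eqxx (negPf ji).
by case: (x i) => /=; rewrite ?mulN1r ?mul1r ?opprK.
Qed.

Section MiddleLayers.
Variables (R : realType) (n w N : nat).
Notation dnf := {ffun 'I_N -> {ffun 'I_w -> 'I_n}}.
Notation index := {ffun 'I_N -> 'I_n}.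
Implicit Types (T : dnf) (k : index) (x y : cube n).
Hypotheses (n_gt0 : (0 < n)%N) (w_gt2 : (2 < w)%N) (NE : N = (2 ^ (w - 2))%N).
Hypothesis w_small : (32 * w ^ 2 <= n)%N.

Let n0 : 0 < n%:R :> R. Proof. by rewrite ltr0n. Qed.
Let w0 : 3 <= w%:R :> R. Proof. by rewrite (ler_nat _ 3 w). Qed.
Let wn : 32 * w%:R ^+ 2 <= n%:R :> R.
Proof. by move: w_small; rewrite -(ler_nat R) natrM natrX. Qed.
Let N0 : 0 < N%:R :> R. Proof. by rewrite NE ltr0n expn_gt0. Qed.
Let D : R := #|{: dnf}|%:R.
Let K : R := #|{: index}|%:R.
Let C : R := #|{: cube n}|%:R.
Let D0 : 0 <= D. Proof. exact: ler0n. Qed.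
Let K0 : 0 <= K. Proof. exact: ler0n. Qed.
Let C0 : 0 <= C. Proof. exact: ler0n. Qed.

(** A relative bias of at most [1 / (4 w)] keeps its power in [mean_sat] between [3 / 4] and 2. *)
Definition middle x : bool := `|bias R x| * (4 * w%:R) <= n%:R.

(** Chebyshev's inequality: the exceptional fraction is at most [16 w ^ 2 / n]. *)
Lemma card_middle : C / 2 <= \sum_(x | middle x) 1.
Proof.
have split1 : \sum_(x | middle x) 1 = C - \sum_(x | ~~ middle x) (1 : R).
  rewrite /C -sum1_card natr_sum [X in _ = X - _](bigID middle) /=.
  by rewrite addrK.
have far : (\sum_(x | ~~ middle x) (1 : R)) * n%:R ^+ 2 <=
    16 * w%:R ^+ 2 * (n%:R * C).
  rewrite -sum_bias_sqr mulr_sumr mulr_suml.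
  apply: (@le_trans _ _ (\sum_(x | ~~ middle x) 16 * w%:R ^+ 2 * bias R x ^+ 2)).
    apply: ler_sum => x; rewrite -ltNge => nx.
    have : n%:R ^+ 2 <= (`|bias R x| * (4 * w%:R)) ^+ 2.
      by apply: lerXn2r; [rewrite nnegrE | rewrite nnegrE !mulr_ge0 | exact: ltW].
    by rewrite exprMn real_normK ?num_real // mul1r; lra.
  rewrite big_mkcond; apply: ler_sum => x _; case: ifP => // _.
  by apply: mulr_ge0; [apply: mulr_ge0 => //|]; exact: sqr_ge0.
have far' : (\sum_(x | ~~ middle x) (1 : R)) * n%:R ^+ 2 <= C / 2 * n%:R ^+ 2.
  apply: le_trans far _.
  have : 32 * w%:R ^+ 2 * (n%:R * C) <= n%:R * (n%:R * C).
    by rewrite ler_wpM2r // mulr_ge0 // ltW.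
  by rewrite expr2; lra.
rewrite ler_pM2r in far'; last by rewrite exprn_gt0.
by rewrite split1; lra.
Qed.

Lemma middle_density x : middle x -> `|2 * density R x - 1| * (4 * w%:R) <= 1.
Proof.
rewrite /middle biasE // normrM ger0_norm ?ler0n //.
by rewrite -mulrA -[leRHS]mulr1 ler_pM2l.
Qed.

Lemma middle_mean x : middle x ->
  3 / 16 <= N%:R * density R x ^+ w <= 1 / 2.
Proof.
move=> /middle_density; rewrite mean_sat //.
have /andP[a0 a1] := density_itv R n_gt0 x.
set b := 2 * density R x - 1 => hb.
have b1 : -1 <= b <= 1 by apply/andP; split; rewrite /b; lra.
have wb : `|b * (4 * w%:R)| <= 1.
  by rewrite normrM [X in _ * X]ger0_norm // mulr_ge0.
move: wb; rewrite ler_norml => /andP[wb1 wb2].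
have h1 : (1 + b) ^+ w <= 2 by apply: pow1D_le2 => //; lra.
have h2 : 1 + w%:R * b <= (1 + b) ^+ w by apply: bernoulli_ineq; case/andP: b1.
by apply/andP; split; lra.
Qed.

Definition live T : R := \sum_(x | middle x) \sum_i (only_sat T x i)%:R.

(** At a middle point the mean number of terms is at least [3 / 16], and given one of them the
    others all fail with probability at least [1 / 2]. Half of the cube is middle. *)
Lemma sum_live : D * (3 / 64 * C) <= \sum_(T : dnf) live T.
Proof.
rewrite /live exchange_big /=.
apply: (@le_trans _ _ (\sum_(x | middle x) D * (3 / 32) * 1)).
  rewrite -mulr_sumr.
  have := card_middle; set s := \sum_(x | _) _ => h.
  have : D * (C / 2) <= D * s by rewrite ler_wpM2l.
  lra.
apply: ler_sum => x xm; rewrite exchange_big /= sum_only_sat // -/D mulr1.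
rewrite ler_wpM2l //.
have /andP[m1 m2] := middle_mean xm.
have /andP[t0 t1] := density_pow_itv R w n_gt0 x.
set t := density R x ^+ w in m1 m2 t0 t1 *.
have h : 1 + N.-1%:R * (- t) <= (1 - t) ^+ N.-1 by apply: bernoulli_ineq; lra.
have h1 : N.-1%:R * t <= N%:R * t by rewrite ler_wpM2r // ler_nat leq_pred.
have h2 : N%:R * t * (1 / 2) <= N%:R * t * (1 - t) ^+ N.-1.
  by rewrite ler_wpM2l ?mulr_ge0 //; lra.
by rewrite mulrA; lra.
Qed.

Lemma density_upd x a : density R x <= density R (upd x a true) <= density R x + n%:R^-1.
Proof.
rewrite /density -[X in _ + X]mul1r -mulrDl !ler_pM2r ?invr_gt0 //.
rewrite !weightE; apply/andP; split.
  by apply: ler_sum => j _; rewrite ffunE ler_nat; case: eqP; case: (x j).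
have e1 : 1 = \sum_j (j == a)%:R :> R.
  by rewrite (bigD1 a) //= eqxx big1 ?addr0 // => j /negPf->.
rewrite [X in _ <= _ + X]e1 -big_split /=; apply: ler_sum => j _.
rewrite ffunE -natrD ler_nat.
by case: eqP; case: (x j).
Qed.

(** The probability that [x] has a single term and that raising [a] satisfies another: the mean
    number of terms at [x] is at most [1 / 2], and raising [a] adds at most [w / n] to it. *)
Lemma middle_upd x a : middle x ->
  N%:R * (density R x ^+ w * (1 - density R x ^+ w) ^+ N.-1
        - density R x ^+ w * (1 - density R (upd x a true) ^+ w) ^+ N.-1)
    <= w%:R / (2 * n%:R).
Proof.
move=> xm; have /andP[m1 m2] := middle_mean xm.
have /andP[t0 t1] := density_pow_itv R w n_gt0 x.
have /andP[t'0 t'1] := density_pow_itv R w n_gt0 (upd x a true).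
have /andP[a0 a1] := density_itv R n_gt0 x.
have /andP[aa' a'a] := density_upd x a.
have e1 := mean_sat R w_gt2 NE x.
have e2 := mean_sat R w_gt2 NE (upd x a true).
rewrite [1 + _]addrC subrK in e1; rewrite [1 + _]addrC subrK in e2.
have bm := middle_density xm.
set d := density R x in m1 m2 t0 t1 a0 a1 aa' a'a e1 bm *.
set d' := density R (upd x a true) in t'0 t'1 aa' a'a e2 *.
set t := d ^+ w in m1 m2 t0 t1 e1 *; set t' := d' ^+ w in t'0 t'1 e2 *.
have w3 : 3 <= w%:R :> R by exact: w0.
have winv : 0 < w%:R^-1 :> R by rewrite invr_gt0; lra.
have ninv : n%:R^-1 <= w%:R^-1 / 8 :> R.
  rewrite -[leRHS]invfM lef_pV2 ?posrE //; last by rewrite mulr_gt0 //; lra.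
  apply: le_trans wn; nra.
have b4 : 2 * d - 1 <= w%:R^-1 / 4.
  have : 2 * d - 1 <= 1 / (4 * w%:R).
    apply: le_trans (ler_norm _) _; rewrite ler_pdivlMr // mulr_gt0 //; lra.
  by rewrite mul1r invfM; lra.
(* The bias of [x] and the raised coordinate each add at most [1 / (4 w)] to [2 * d']. *)
have pw : (2 * d') ^+ w.-1 <= 2.
  have h1 : (2 * d') ^+ w.-1 <= (1 + w%:R^-1 / 2) ^+ w.-1.
    by apply: lerXn2r; rewrite ?nnegrE; lra.
  apply: le_trans h1 _.
  have h2 : (1 + w%:R^-1 / 2) ^+ w.-1 <= (1 + w%:R^-1 / 2) ^+ w :> R.
    by apply: ler_weXn2l; [lra | exact: leq_pred].
  apply: le_trans h2 _; apply: pow1D_le2.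
    have : w%:R^-1 <= 1 :> R by rewrite invf_le1; lra.
    by move=> ?; apply/andP; split; lra.
  by rewrite mulrA divff ?mul1r // gt_eqF; lra.
have tt' : 0 <= t' - t by rewrite subr_ge0; apply: lerXn2r; rewrite ?nnegrE //; lra.
have h1 : N%:R * (t' - t) <= w%:R / n%:R.
  have -> : N%:R * (t' - t) = ((2 * d') ^+ w - (2 * d) ^+ w) / 4 by lra.
  have : (2 * d') ^+ w - (2 * d) ^+ w <= w%:R * ((2 * d' - 2 * d) * (2 * d') ^+ w.-1).
    by apply: expr_sub_le; lra.
  have : w%:R * ((2 * d' - 2 * d) * (2 * d') ^+ w.-1) <= w%:R * (2 * n%:R^-1 * 2).
    apply: ler_wpM2l => //; apply: ler_pM => //; try lra.
    by rewrite exprn_ge0 //; lra.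
  lra.
have h2 : (1 - t) ^+ N.-1 - (1 - t') ^+ N.-1 <= N%:R * (t' - t).
  apply: (@le_trans _ _ (N.-1%:R * (((1 - t) - (1 - t')) * (1 - t) ^+ N.-1.-1))).
    by apply: expr_sub_le; lra.
  have -> : (1 - t) - (1 - t') = t' - t by ring.
  apply: ler_pM => //; first by rewrite mulr_ge0 ?exprn_ge0 //; lra.
    by rewrite ler_nat leq_pred.
  by rewrite ler_piMr // exprn_ile1 //; lra.
rewrite -mulrBr mulrA.
have nt0 : 0 <= N%:R * t by rewrite mulr_ge0.
have h3 : N%:R * t * ((1 - t) ^+ N.-1 - (1 - t') ^+ N.-1) <= N%:R * t * (w%:R / n%:R).
  by rewrite ler_wpM2l //; apply: le_trans h1.
have h4 : N%:R * t * (w%:R / n%:R) <= 1 / 2 * (w%:R / n%:R).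
  by rewrite ler_wpM2r // divr_ge0.
by rewrite invfM; lra.
Qed.

Definition ruined T k : R :=
  \sum_(x | middle x) \sum_i (only_sat T x i && ~~ pivotal T k x i)%:R.

(** Two ways to fail: term [i] reads [k i], treated by a union bound over its literals, or raising
    [k i] satisfies another term. *)
Lemma not_pivotal_le T k x i :
  (only_sat T x i && ~~ pivotal T k x i)%:R <=
  (only_sat T x i)%:R * (\sum_l (T i l == k i)%:R) + ((only_sat T x i)%:R -
   (sat x (T i) && [forall j, (j != i) ==> ~~ sat (upd x (k i) true) (T j)])%:R) :> R.
Proof.
have up j : x j -> upd x (k i) true j by rewrite ffunE; case: eqP.
have s0 : 0 <= \sum_l (T i l == k i)%:R :> R by apply: sumr_ge0.
set B := [forall j, _].
have Bx : sat x (T i) && B -> only_sat T x i.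
  case/andP=> xi /forallP h; rewrite /only_sat xi; apply/forallP => j.
  apply/implyP => ji; apply: contra (implyP (h j) ji); exact: sat_mono.
case: (boolP (only_sat T x i)) => xi /=; last first.
  by rewrite mul0r add0r; case: (boolP (_ && B)) => [/Bx|_]; rewrite ?(negPf xi) ?subrr.
rewrite mul1r; have /andP[xs _] := xi; rewrite xs /=.
case: (boolP (pivotal T k x i)) => /= [_|].
  by rewrite addr_ge0 // subr_ge0 lern1 leq_b1.
rewrite /pivotal xi /= negb_and => /orP[/forallPn[l]|].
  rewrite negbK => /eqP tl; apply: (@le_trans _ _ (\sum_l (T i l == k i)%:R)).
    by rewrite (bigD1 l) //= tl eqxx lerDl sumr_ge0.
  by rewrite lerDl subr_ge0 lern1 leq_b1.
rewrite /only_sat (sat_mono up xs) /= -/B => /negPf->.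
by rewrite subr0 lerDr.
Qed.

Lemma sum_ruined :
  \sum_(T : dnf) \sum_(k : index) ruined T k <= D * K * (C * (2 * w%:R / n%:R)).
Proof.
have pt x : middle x ->
    \sum_i \sum_(T : dnf) \sum_(k : index)
      (only_sat T x i && ~~ pivotal T k x i)%:R <= D * K * (2 * w%:R / n%:R) :> R.
  move=> xm.
  pose B T k i := (sat x (T i) &&
    [forall j, (j != i) ==> ~~ sat (upd x (k i) true) (T j)])%:R : R.
  (* A term reads a uniform coordinate with probability at most [w / n]; the second failure costs
     [w / (2 n)], shared equally among the [N] indices. *)
  apply: (@le_trans _ _ (\sum_i \sum_(T : dnf)
      (only_sat T x i)%:R * (K * (w%:R / n%:R)) +
      \sum_(i < N) D * K * (w%:R / (2 * n%:R) / N%:R))); last first.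
    rewrite sumr_const card_ord -[_ *+ N]mulr_natl.
    under eq_bigr do rewrite -mulr_suml.
    rewrite -mulr_suml.
    have h1 := sum_only_sat_le R w N n_gt0 x; rewrite -/D in h1.
    have h2 : 0 <= K * (w%:R / n%:R) by rewrite mulr_ge0 // divr_ge0.
    have := ler_wpM2r h2 h1.
    have -> : N%:R * (D * K * (w%:R / (2 * n%:R) / N%:R)) =
        D * K * (w%:R / n%:R) / 2.
      by field; rewrite !gt_eqF.
    have := mulr_ge0 D0 h2; lra.
  rewrite -big_split /=; apply: ler_sum => i _.
  apply: (@le_trans _ _ (\sum_(T : dnf) \sum_(k : index)
     ((only_sat T x i)%:R * (\sum_l (T i l == k i)%:R) +
      ((only_sat T x i)%:R - B T k i)))).
    by apply: ler_sum => T _; apply: ler_sum => k _; apply: not_pivotal_le.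
  under [leLHS]eq_bigr do rewrite big_split /=.
  rewrite [leLHS]big_split /=; apply: lerD.
    apply: ler_sum => T _; rewrite -mulr_sumr ler_wpM2l // exchange_big /=.
    rewrite le_eqVlt; apply/orP; left; apply/eqP.
    rewrite (eq_bigr (fun=> K / n%:R)) => [|l _].
      by rewrite sumr_const card_ord -[_ *+ w]mulr_natl; ring.
    have nz : n%:R != 0 :> R by rewrite gt_eqF.
    apply: (mulfI nz); rewrite [RHS]mulrC divfK //.
    have := sum_upd i (fun k : index => (T i l == k i)%:R : R).
    rewrite card_ord => <-; rewrite (eq_bigr (fun=> 1)) ?sumr_const // => k _.
    rewrite (bigD1 (T i l)) //= ffunE !eqxx big1 ?addr0 // => j jl.
    by rewrite ffunE eqxx eq_sym (negPf jl).
  rewrite exchange_big /=.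
  apply: (@le_trans _ _ (\sum_(k : index) D * (w%:R / (2 * n%:R) / N%:R))).
    apply: ler_sum => k _; rewrite sumrB !sum_one_term // -/D !card_sat // -mulrBr.
    by rewrite ler_wpM2l // ler_pdivlMr // mulrC; apply: middle_upd.
  by rewrite sumr_const -[_ *+ _]mulr_natl -/K; lra.
rewrite /ruined.
under eq_bigr do rewrite exchange_big /=.
rewrite exchange_big /=.
apply: (@le_trans _ _ (\sum_(x | middle x) D * K * (2 * w%:R / n%:R))).
  apply: ler_sum => x xm; apply: le_trans (pt x xm).
  under eq_bigr do rewrite exchange_big /=.
  by rewrite exchange_big.
rewrite sumr_const -[_ *+ _]mulr_natl.
have h : 0 <= D * K * (2 * w%:R / n%:R) by rewrite !mulr_ge0 // invr_ge0 ltW.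
have : #|middle|%:R * (D * K * (2 * w%:R / n%:R)) <= C * (D * K * (2 * w%:R / n%:R)).
  by rewrite ler_wpM2r // ler_nat max_card.
lra.
Qed.

End MiddleLayers.

(** * Testers *)

Section QuerySets.
Variable n : nat.
Implicit Types (A : query_alg n) (f g : boolfun n).

Definition determined_by A (S : seq (cube n)) : Prop :=
  forall f g, {in S, f =1 g} -> output A f = output A g.

Lemma output_queries A f g : {in queries A f, f =1 g} -> output A f = output A g.
Proof.
elim: A => //= x k IH h.
rewrite -(h x (mem_head _ _)); apply: IH => y yq; apply: h.
by rewrite inE yq orbT.
Qed.

(* Restricting to the oracles in [F] discards the branches of the tree that
   repeated queries make unreachable, whose depth is not controlled. *)
Lemma query_tree_support A q (F : boolfun n -> Prop) :
  (forall f, F f -> (size (queries A f) <= q)%N) ->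
  exists S : seq (cube n), (size S < 2 ^ q)%N /\
    forall f g, F f -> F g -> {in S, f =1 g} -> output A f = output A g.
Proof.
elim: A q F => [b|x k IH] q F Fq; first by exists [::]; rewrite expn_gt0.
(* With no oracle in [F] the empty set serves; otherwise the query at the root forces [0 < q]. *)
case: (pselect (exists f, F f)) => [[f0 /Fq]|nF]; last first.
  by exists [::]; rewrite expn_gt0; split=> // f g Ff; case: nF; exists f.
case: q Fq => //= q Fq _.
have Fb b f : (F f /\ f x = b) -> (size (queries (k b) f) <= q)%N.
  by case=> /Fq /= + <-.
have [S1 [sz1 S1P]] := IH true q _ (Fb true).
have [S2 [sz2 S2P]] := IH false q _ (Fb false).
exists (x :: S1 ++ S2); split=> [|f g Ff Fg h].
  rewrite /= size_cat expnS mul2n -addnn; apply: leq_trans (leq_add sz1 sz2).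
  by rewrite addSn addnS.
have fgx : f x = g x by apply: h; rewrite mem_head.
have h1 : {in S1, f =1 g} by move=> y yS; apply: h; rewrite inE mem_cat yS orbT.
have h2 : {in S2, f =1 g} by move=> y yS; apply: h; rewrite inE mem_cat yS !orbT.
rewrite -fgx; case fx: (f x); rewrite fx in fgx.
  by apply: S1P.
by apply: S2P.
Qed.

End QuerySets.

(** Integrates over the seed an inequality that holds for each deterministic algorithm. *)
Lemma probability_sum_le (R : realType) (d : measure_display)
    (Omega : measurableType d) (P : probability Omega R) (I : finType)
    (c : I -> R) (E F : I -> set Omega) (M : R) :
  (forall i, 0 <= c i) -> 0 <= M ->
  (forall i, measurable (E i)) -> (forall i, measurable (F i)) ->
  (forall x, \sum_i c i * (x \in E i)%:R <= M + \sum_i c i * (x \in F i)%:R) ->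
  \sum_i c i * fine (P (E i)) <= M + \sum_i c i * fine (P (F i)).
Proof.
move=> c0 M0 mE mF h.
have mind (G : I -> set Omega) i : measurable (G i) ->
    measurable_fun setT (fun x => ((c i)%:E * (\1_(G i) x)%:E)%E).
  move=> mG; apply/measurable_EFinP; apply: measurable_funM; first exact: measurable_cst.
  exact: measurable_indic.
have ind0 (G : I -> set Omega) i x : (0 <= (c i)%:E * (\1_(G i) x)%:E)%E.
  by rewrite -EFinM lee_fin mulr_ge0 // indicE.
have intE (G : I -> set Omega) : (forall i, measurable (G i)) ->
    (\int[P]_x (\sum_i (c i)%:E * (\1_(G i) x)%:E))%E =
    (\sum_i c i * fine (P (G i)))%:E.
  move=> mG; rewrite ge0_integral_sum //; last by move=> i; apply: mind.
  rewrite -sumEFin; apply: eq_bigr => i _.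
  rewrite ge0_integralZl_EFin //; last first.
    by apply/measurable_EFinP; exact: measurable_indic.
  by rewrite integral_indic // setIT EFinM fineK // fin_num_measure.
rewrite -lee_fin EFinD -!intE //.
have -> : (M%:E = \int[P]_x M%:E)%E.
  by rewrite integral_cst //= probability_setT mule1.
rewrite -ge0_integralD //; last 2 first.
- by move=> x _; apply: sume_ge0.
- by apply: emeasurable_sum => i; apply: mind.
apply: ge0_le_integral => //.
- by move=> x _; apply: sume_ge0.
- by apply: emeasurable_sum => i; apply: mind.
- apply: emeasurable_funD => //.
  by apply: emeasurable_sum => i; apply: mind.
move=> x _; under eq_bigr do rewrite indicE -EFinM.
under [X in (_ <= _ + X)%E]eq_bigr do rewrite indicE -EFinM.
by rewrite !sumEFin -EFinD lee_fin.
Qed.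

(** * The advantage of a tester on the two random functions *)

Section LowerBound.
Variables (R : realType) (n w N : nat).
Notation dnf := {ffun 'I_N -> {ffun 'I_w -> 'I_n}}.
Notation index := {ffun 'I_N -> 'I_n}.
Implicit Types (T : dnf) (k : index) (x y : cube n).
Hypotheses (n_gt0 : (0 < n)%N) (w_gt2 : (2 < w)%N) (NE : N = (2 ^ (w - 2))%N).
Hypothesis w_small : (32 * w ^ 2 <= n)%N.

Let C : R := #|{: cube n}|%:R.
Let D : R := #|{: dnf}|%:R.
Let K : R := #|{: index}|%:R.

Lemma card_cube_gt0 : 0 < C.
Proof. by rewrite ltr0n card_ffun card_bool expn_gt0. Qed.

Lemma live_ge0 T : 0 <= live R T.
Proof. by apply: sumr_ge0 => x _; apply: sumr_ge0. Qed.

Lemma exists_only_satE T x (Q : pred 'I_N) :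
  (forall i, Q i -> only_sat T x i) ->
  \sum_i (Q i)%:R = [exists i, Q i]%:R :> R.
Proof.
move=> QT; case: (boolP [exists i, Q i]) => [/existsP[i Qi]|/existsPn nQ].
  rewrite (bigD1 i) //= Qi big1 ?addr0 // => j ji.
  case: (boolP (Q j)) => // /QT /andP[xj _].
  by rewrite (only_sat_inj (QT i Qi) xj) eqxx in ji.
by rewrite big1 // => i _; rewrite (negPf (nQ i)).
Qed.

Lemma live_le T : live R T <= C.
Proof.
rewrite /live big_mkcond /= /C -[X in _ <= X%:R]sum1_card natr_sum.
apply: ler_sum => x _; case: ifP => // _.
by rewrite (exists_only_satE (T := T) (x := x)) // ler_nat leq_b1.
Qed.

(** A live point that is not ruined is pivotal, so [pivotal_disagree] applies. *)
Lemma live_le_disagree T k (g : boolfun n) : Defs.monotone g ->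
  live R T <= 2 * (C * Defs.dist R (talagrand T k [ffun=> true]) g) + ruined R T k.
Proof.
move=> gm; rewrite /Defs.dist -/C [C * _]mulrC divfK ?gt_eqF ?card_cube_gt0 //.
have := pivotal_disagree T k gm; rewrite -(ler_nat R) natrM.
set dis := #|_|%:R => h.
suff : live R T - ruined R T k <= #|[pred x | [exists i, pivotal T k x i]]|%:R by lra.
rewrite /live /ruined -sumrB -sum1_card natr_sum big_mkcond [leRHS]big_mkcond /=.
apply: ler_sum => x _; rewrite inE.
rewrite -sumrB (eq_bigr (fun i => (pivotal T k x i)%:R)); last first.
  move=> i _; case: (boolP (pivotal T k x i)) => [/and3P[-> _ _]|_] /=.
    by rewrite subr0.
  by rewrite andbT subrr.
rewrite (exists_only_satE (T := T) (x := x)); last by move=> i /and3P[].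
by case: ifP => _; case: [exists _, _].
Qed.

Variables (d : measure_display) (Omega : measurableType d).
Variables (P : probability Omega R) (A : Omega -> query_alg n).
Variables (eps : R) (s : nat).
Hypothesis eps_ge0 : 0 <= eps.
Hypothesis A_tester : monotonicity_tester eps P A.
Hypothesis A_support : forall om, exists S : seq (cube n),
  (size S <= s)%N /\ determined_by (A om) S.

Let acc (b : bool) T k := [set om | output (A om) (talagrand T k [ffun=> b]) = true].

(** The weight [live R T] depends on [T] alone, so [hybrid] applies for each [T] and each seed. *)
Lemma acceptance_gap :
  \sum_T \sum_k live R T * fine (P (acc false T k)) <=
  D * K * (C * (16 * s%:R + 4 * s%:R ^+ 2) / w%:R) +
  \sum_T \sum_k live R T * fine (P (acc true T k)).
Proof.
have w0 : 0 < w%:R :> R by rewrite ltr0n (leq_trans _ w_gt2).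
have n0 : 0 < n%:R :> R by rewrite ltr0n.
case: A_tester => mA _ _.
rewrite !pair_big /=.
apply: (@probability_sum_le _ _ _ P _ (fun p : dnf * index => live R p.1)
  (fun p => acc false p.1 p.2) (fun p => acc true p.1 p.2)).
- by move=> p; apply: live_ge0.
- by rewrite !mulr_ge0 ?invr_ge0 // ?addr_ge0 ?mulr_ge0 ?exprn_ge0 // ltW.
- by move=> p; apply: mA.
- by move=> p; apply: mA.
move=> om; have [S [szS AS]] := A_support om.
have accE b T k : (om \in acc b T k) = output (A om) (talagrand T k [ffun=> b]).
  by apply/idP/idP; rewrite inE.
under eq_bigr do rewrite accE; under [in leRHS]eq_bigr do rewrite accE.
rewrite -(pair_big xpredT xpredT (fun T k => live R T *
  (output (A om) (talagrand T k [ffun=> false]))%:R)) /=.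
rewrite -(pair_big xpredT xpredT (fun T k => live R T *
  (output (A om) (talagrand T k [ffun=> true]))%:R)) /=.
rewrite -lerBlDr -sumrB.
apply: (@le_trans _ _ (\sum_(T : dnf) C * (K / n%:R * \sum_i group_dev R S T i))).
  apply: ler_sum => T _; rewrite -!mulr_sumr -mulrBr -sumrB.
  have := hybrid R AS T; rewrite -/K => h.
  set X := \sum_k _.
  have hX : `|X| <= K / n%:R * \sum_i group_dev R S T i.
    rewrite mulrAC ler_pdivlMr // mulrC; apply: le_trans h.
    rewrite -normrN /X -sumrN le_eqVlt; apply/orP; left; apply/eqP.
    by congr (_ * `|_|); apply: eq_bigr => k _; rewrite opprB.
  apply: (@le_trans _ _ (live R T * `|X|)).
    by rewrite ler_wpM2l ?live_ge0 // ler_norm.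
  by apply: ler_pM; rewrite ?live_ge0 ?live_le.
rewrite -!mulr_sumr.
have h1 := sum_group_dev R n_gt0 w_gt2 NE S; rewrite -/D in h1.
have sS : (size S)%:R <= s%:R :> R by rewrite ler_nat.
have h2 : 16 * (size S)%:R + 4 * (size S)%:R ^+ 2 <= 16 * s%:R + 4 * s%:R ^+ 2 :> R.
  have : (size S)%:R ^+ 2 <= s%:R ^+ 2 :> R by apply: lerXn2r; rewrite ?nnegrE.
  lra.
apply: (@le_trans _ _ (C * (K / n%:R * (D *
    (n%:R * (16 * s%:R + 4 * s%:R ^+ 2) / w%:R))))).
  apply: ler_wpM2l; first exact: ler0n.
  apply: ler_wpM2l; first by rewrite divr_ge0.
  apply: le_trans h1 _; apply: ler_wpM2l; first exact: ler0n.
  by rewrite ler_pM2r ?invr_gt0 // ler_pM2l.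
rewrite le_eqVlt; apply/orP; left; apply/eqP; field.
by rewrite !gt_eqF.
Qed.

(** The weighted acceptance is at least [2 / 3] of the live mass on the monotone side and about
    [1 / 3] on the other; a third of the average live fraction [3 / 64] gives [1 / 64]. *)
Lemma tester_query_bound :
  1 / 64 <= (16 * s%:R + 4 * s%:R ^+ 2) / w%:R + 2 * eps + 2 * w%:R / n%:R.
Proof.
have C0 := card_cube_gt0.
have D0 : 0 < D by rewrite ltr0n card_ffun card_ffun !card_ord !expn_gt0 n_gt0.
have K0 : 0 < K by rewrite ltr0n card_ffun !card_ord !expn_gt0 n_gt0.
case: (A_tester) => mA Ay An.
have yes T k : 2 / 3 <= fine (P (acc false T k)).
  rewrite -lee_fin fineK ?fin_num_measure //; last exact: mA.
  exact: Ay (talagrand_monotone T k).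
(* A negative function that is not far from monotone has its entire weight charged to its distance
   and its ruined points. *)
have no T k : live R T * fine (P (acc true T k)) <=
    live R T / 3 + 2 * (C * eps) + ruined R T k.
  have L0 := live_ge0 T.
  have ru0 : 0 <= ruined R T k by apply: sumr_ge0 => x _; apply: sumr_ge0.
  have Ce0 : 0 <= C * eps by rewrite mulr_ge0 // ltW.
  case: (pselect (far_from_monotone eps (talagrand T k [ffun=> true]))) => [far|nfar].
    suff : live R T * fine (P (acc true T k)) <= live R T * (1 / 3) by lra.
    apply: ler_wpM2l => //; rewrite -lee_fin fineK ?fin_num_measure //; last exact: mA.
    have := An _ far.
    have -> : [set om | output (A om) (talagrand T k [ffun=> true]) = false] =
        ~` acc true T k.
      apply/seteqP; split=> om h; last by apply/negbTE/negP => h'; apply: h.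
      by move=> h'; move: h; rewrite /= h'.
    rewrite probability_setC; last exact: mA.
    have : P (acc true T k) \is a fin_num by rewrite fin_num_measure //; exact: mA.
    case: (P _) => //= r _; rewrite !lee_fin; lra.
  have [g gm gd] : exists2 g, Defs.monotone g &
      Defs.dist R (talagrand T k [ffun=> true]) g <= eps.
    apply: contrapT => h; apply: nfar => g gm; rewrite ltNge; apply/negP => gd.
    by apply: h; exists g.
  have h1 := live_le_disagree T k gm.
  have h2 : C * Defs.dist R (talagrand T k [ffun=> true]) g <= C * eps.
    by rewrite ler_pM2l.
  have h3 : live R T * fine (P (acc true T k)) <= live R T.
    rewrite ler_piMr // -lee_fin fineK ?fin_num_measure //; last exact: mA.
    by apply: probability_le1; exact: mA.
  lra.
have gap := acceptance_gap.
have lower : \sum_(T : dnf) \sum_(k : index) live R T * (2 / 3) <=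
    \sum_(T : dnf) \sum_(k : index) live R T * fine (P (acc false T k)).
  apply: ler_sum => T _; apply: ler_sum => k _; apply: ler_wpM2l => //.
  exact: live_ge0.
have upper : \sum_(T : dnf) \sum_(k : index) live R T * fine (P (acc true T k)) <=
    \sum_(T : dnf) \sum_(k : index) (live R T / 3 + 2 * (C * eps) + ruined R T k).
  by apply: ler_sum => T _; apply: ler_sum => k _.
have lowerE : \sum_(T : dnf) \sum_(k : index) live R T * (2 / 3) =
    K * (2 / 3) * \sum_(T : dnf) live R T.
  rewrite mulr_sumr; apply: eq_bigr => T _.
  by rewrite sumr_const -[_ *+ _]mulr_natl -/K; ring.
have upperE : \sum_(T : dnf) \sum_(k : index)
      (live R T / 3 + 2 * (C * eps) + ruined R T k) =
    K / 3 * (\sum_(T : dnf) live R T) + D * K * (2 * (C * eps)) +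
    \sum_(T : dnf) \sum_(k : index) ruined R T k.
  rewrite mulr_sumr.
  have -> : D * K * (2 * (C * eps)) = \sum_(T : dnf) K * (2 * (C * eps)).
    by rewrite sumr_const -[_ *+ _]mulr_natl -/D; ring.
  rewrite -!big_split /=; apply: eq_bigr => T _.
  by rewrite big_split /= sumr_const -[_ *+ _]mulr_natl -/K; ring.
have rul := sum_ruined R n_gt0 w_gt2 NE w_small.
have liv := sum_live R n_gt0 w_gt2 NE w_small.
rewrite -/D -/K -/C in rul liv gap.
have liv' : K / 3 * (D * (3 / 64 * C)) <= K / 3 * \sum_(T : dnf) live R T.
  by rewrite ler_wpM2l // divr_ge0 // ltW.
have DKC : 0 < D * K * C by rewrite !mulr_gt0.
rewrite -(ler_pM2l DKC).
rewrite lowerE in lower; rewrite upperE in upper.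
lra.
Qed.

End LowerBound.

(** * Choice of the parameters and query lower bounds *)

Lemma exists_width n : exists w, (32 * w ^ 2 <= n < 32 * w.+1 ^ 2)%N.
Proof.
have ex0 : exists w, (32 * w ^ 2 <= n)%N by exists 0%N.
have bnd w : (32 * w ^ 2 <= n)%N -> (w <= n)%N.
  apply: leq_trans; rewrite -mulnn; case: w => // w.
  by rewrite mulnA leq_pmull.
case: (ex_maxnP ex0 bnd) => w wn wmax; exists w; rewrite wn ltnNge.
by apply/negP => /wmax; rewrite ltnn.
Qed.

Lemma no_small_support_tester (R : realType) : exists N0 : nat,
  forall n : nat, (N0 <= n)%N ->
  forall (d : measure_display) (Omega : measurableType d)
    (P : probability Omega R) (A : Omega -> query_alg n) (s : nat),
    monotonicity_tester (1 / 400) P A ->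
    (forall om, exists S : seq (cube n),
       (size S <= s)%N /\ determined_by (A om) S) ->
    (n < s ^ 5)%N.
Proof.
(* With [20 / c = 1 / 200], the three terms of [tester_query_bound] sum to at most
   [1 / 200 + 1 / 200 + 1 / 1000], below [1 / 64]. *)
have [c c4000] : exists c : R, c = 4000 by exists 4000.
have c0 : 0 <= c by lra.
have c5 : 0 <= c ^+ 5 by rewrite exprn_ge0.
pose W := (Num.bound (c ^+ 5 * 128 ^+ 2)).+4.
exists (32 * W ^ 2)%N => n nW d Omega P A s At As; rewrite ltnNge; apply/negP => sn.
have [w /andP[wn nw]] := exists_width n.
have Ww : (W <= w)%N.
  rewrite leqNgt; apply/negP => wW.
  by have := leq_ltn_trans nW nw; rewrite ltn_mul2l /= ltn_sqr ltnS leqNgt wW.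
have w2 : (2 < w)%N by apply: leq_trans Ww.
have n0 : (0 < n)%N by apply: leq_trans nW; rewrite muln_gt0 expn_gt0.
have e0 : 0 <= 1 / 400 :> R by lra.
have := tester_query_bound n0 w2 (erefl _) wn e0 At As.
have w0 : 3 <= w%:R :> R by rewrite (ler_nat _ 3 w).
have cw : c ^+ 5 * 128 ^+ 2 < w%:R.
  have Wr : W%:R <= w%:R :> R by rewrite ler_nat.
  apply: lt_le_trans Wr.
  apply: lt_le_trans (_ : (Num.bound (c ^+ 5 * 128 ^+ 2))%:R <= _).
    apply: archi_boundP; exact: mulr_ge0 c5 (exprn_ge0 2 (ler0n R 128)).
  by rewrite ler_nat; do 4 apply: leqW.
have sw : s%:R ^+ 5 <= 128 * w%:R ^+ 2 :> R.
  rewrite -natrX; apply: (@le_trans _ _ (32 * w.+1 ^ 2)%:R).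
    by rewrite ler_nat; apply: leq_trans sn (ltnW nw).
  rewrite natrM natrX -natr1.
  have : (w%:R + 1) ^+ 2 <= (2 * w%:R) ^+ 2 :> R by apply: lerXn2r; rewrite ?nnegrE; lra.
  by rewrite exprMn; lra.
(* Otherwise fifth powers give [w ^ 5 <= c ^ 5 s ^ 10 <= c ^ 5 128 ^ 2 w ^ 4], against the choice of
   [W]. *)
have key : c * s%:R ^+ 2 <= w%:R.
  rewrite leNgt; apply/negP => lt.
  have h1 : w%:R ^+ 5 <= (c * s%:R ^+ 2) ^+ 5.
    apply: lerXn2r; last exact: ltW.
      by rewrite nnegrE.
    by rewrite nnegrE; apply: mulr_ge0 c0 (exprn_ge0 _ _).
  have h2 : s%:R ^+ 5 * s%:R ^+ 5 <= (128 * w%:R ^+ 2) * (128 * w%:R ^+ 2) :> R.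
    by apply: (ler_pM _ _ sw sw); exact: exprn_ge0.
  have h3 : (c * s%:R ^+ 2) ^+ 5 <= c ^+ 5 * 128 ^+ 2 * w%:R ^+ 4.
    have := ler_wpM2l c5 h2; rewrite exprMn -exprM -!exprD.
    by move=> h; apply: le_trans h _; rewrite le_eqVlt; apply/orP; left; apply/eqP; ring.
  have h4 : w%:R ^+ 5 = w%:R * w%:R ^+ 4 :> R by rewrite exprS.
  have w4 : 0 < w%:R ^+ 4 :> R by rewrite exprn_gt0 //; lra.
  have := le_trans h1 h3; rewrite h4 ler_pM2r // leNgt => /negP; apply.
  exact: cw.
have ss : s%:R <= s%:R ^+ 2 :> R.
  by rewrite -natrX ler_nat; case: (s) => // m; rewrite leq_pmulr.
have i1 : (16 * s%:R + 4 * s%:R ^+ 2) / w%:R <= 20 / c.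
  rewrite ler_pdivrMr; last by lra.
  rewrite mulrAC ler_pdivlMr; last by lra.
  have := ler_wpM2l c0 ss; lra.
have i2 : 2 * w%:R / n%:R <= 1 / 1000 :> R.
  have c1 : 1 <= c by rewrite c4000 ler1n.
  have cw' : c <= w%:R.
    apply: le_trans (ltW cw); rewrite exprS -mulrA ler_peMr //.
    by rewrite mulr_ege1 ?exprn_ege1 // ler1n.
  have := ler_wpM2r (ler0n R w) cw'.
  have : 32 * w%:R ^+ 2 <= n%:R :> R by rewrite -natrX -natrM ler_nat.
  rewrite ler_pdivrMr ?ltr0n // c4000 expr2; lra.
rewrite c4000 in i1; lra.
Qed.

Theorem theorem1p1 (R : realType) :
  exists eps0 : R, 0 < eps0 /\
    (exists (c : R) (N : nat), 0 < c /\
      forall n : nat, (N <= n)%N ->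
      forall (d : measure_display) (Omega : measurableType d)
        (P : probability Omega R) (A : Omega -> query_alg n) (q : nat),
        monotonicity_tester eps0 P A -> nonadaptive A -> makes_at_most A q ->
        c * (n%:R `^ (1 / 5) * ln n%:R `^ (- (2 / 5))) <= q%:R) /\
    (exists (c : R) (N : nat), 0 < c /\
      forall n : nat, (N <= n)%N ->
      forall (d : measure_display) (Omega : measurableType d)
        (P : probability Omega R) (A : Omega -> query_alg n) (q : nat),
        monotonicity_tester eps0 P A -> makes_at_most A q ->
        c * ln n%:R <= q%:R).
Proof.
have [N0 noT] := no_small_support_tester R.
exists (1 / 400); split; first by lra.
split.
  (* The second threshold ensures [ln n >= 1], so the logarithmic factor is at most 1 and
     [n < q ^ 5] suffices. *)
  exists 1, (maxn N0 (Num.bound (expR 1 : R))); split=> // n.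
  rewrite geq_max => /andP[nN nb] d Omega P A q At Anon Aq; rewrite mul1r.
  have ne : expR 1 <= n%:R :> R.
    apply: le_trans (_ : (Num.bound (expR 1 : R))%:R <= _); last by rewrite ler_nat.
    by apply: ltW; apply: archi_boundP; apply: expR_ge0.
  have n0 : 0 < n%:R :> R by apply: lt_le_trans ne; apply: expR_gt0.
  have l1 : 1 <= ln n%:R :> R by rewrite -[leLHS]expRK ler_ln ?posrE ?expR_gt0.
  have : (n < q ^ 5)%N.
    apply: (noT n nN d Omega P A) => // om.
    (* By nonadaptivity, the queries made to one fixed oracle are those made to every oracle. *)
    exists (queries (A om) [ffun=> false]); split; first exact: Aq.
    by move=> f g fg; apply: output_queries; rewrite (Anon om f [ffun=> false]).
  rewrite -(ltr_nat R) natrX => nq.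
  have lle : ln n%:R `^ (- (2 / 5)) <= 1 :> R.
    rewrite powRN invf_le1; last by rewrite powR_gt0 //; lra.
    by rewrite -[leLHS](powRr0 (ln n%:R)) ler_powR // divr_ge0.
  apply: (@le_trans _ _ (n%:R `^ (1 / 5))).
    by rewrite ler_piMr // powR_ge0.
  rewrite leNgt; apply/negP => qn; move: nq; apply/negP; rewrite -leNgt.
  apply: (@le_trans _ _ ((n%:R `^ (1 / 5)) ^+ 5)).
    by apply: lerXn2r; rewrite ?nnegrE ?powR_ge0 // ltW.
  by rewrite -powR_mulrn ?powR_ge0 // -powRrM mulfVK // powRr1 // ltW.
(* Here [n < 2 ^ (5 q)], and [2 <= e] turns this into [ln n <= 5 q]. *)
exists (1 / 5), (maxn N0 1); split=> [|n]; first by lra.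
rewrite geq_max => /andP[nN n1] d Omega P A q At Aq.
have n0 : 0 < n%:R :> R by rewrite ltr0n.
have : (n < (2 ^ q) ^ 5)%N.
  apply: (noT n nN d Omega P A) => // om.
  have [S [szS SP]] := @query_tree_support n (A om) q (fun=> True) (fun f _ => Aq om f).
  by exists S; split; [exact: ltnW | move=> f g fg; apply: SP].
rewrite -expnM -(ltr_nat R) natrX => nq.
have : n%:R <= expR ((q * 5)%:R * 1) :> R.
  apply: ltW; apply: lt_le_trans nq _; rewrite expRM_natl.
  apply: lerXn2r; rewrite ?nnegrE ?expR_ge0 //.
  exact: expR_ge1Dx.
rewrite -ler_ln ?posrE ?expR_gt0 // expRK natrM; lra.
Qed.
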